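(* Let $E$ be a nonempty subset of a real Hilbert space $X$, let $f:E\to\mathbb{R}$, $G:E\to X$ be functions and $M>0$. Suppose that $(f,G)$ satisfies property $(W^{1,1})$ with constant $M$ on $E$, that is, $$f(y)\le f(x)+\frac12\langle G(x)+G(y),y-x\rangle+\frac{M}{4}\|x-y\|^2-\frac{1}{4M}\|G(x)-G(y)\|^2\quad\text{for all }x,y\in E.$$ Then the formula $$F=\mathrm{conv}(g)-\tfrac{M}{2}\|\cdot\|^2,\qquad g(x)=\inf_{y\in E}\Big\{f(y)+\langle G(y),x-y\rangle+\tfrac{M}{2}\|x-y\|^2\Big\}+\tfrac{M}{2}\|x\|^2,\quad x\in X,$$ defines a $C^{1,1}(X)$ function with $F|_E=f$, $(\nabla F)|_E=G$, and $\mathrm{Lip}(\nabla F)\le M$. Moreover, if $H:X\to\mathbb{R}$ is another $C^{1,1}$ function with $H=f$ and $\nabla H=G$ on $E$ and $\mathrm{Lip}(\nabla H)\le M$, then $H\le F$ on $X$.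
   Context: For $g:X\to\mathbb{R}$, the convex envelope is $\mathrm{conv}(g)(x)=\sup\{\phi(x):\phi\text{ is convex, proper and lower semicontinuous on }X,\ \phi\le g\}$. $C^{1,1}(X)$ is the set of differentiable functions $X\to\mathbb{R}$ with Lipschitz gradient; $\mathrm{Lip}(\nabla F)$ is the Lipschitz constant of $\nabla F$. *)

(* Defs.v *)
From mathcomp Require Import all_boot all_order all_algebra sesquilinear.
From mathcomp Require Import all_classical all_reals all_analysis.
Import Order.TTheory GRing.Theory Num.Theory.
Import numFieldNormedType.Exports.

Set Implicit Arguments.
Unset Strict Implicit.
Unset Printing Implicit Defensive.

Local Open Scope classical_set_scope.
Local Open Scope ring_scope.

Section ConvexEnvelope.
Context {R : realType} {X : normedModType R}.
Implicit Types (phi : X -> \bar R) (g : X -> R).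

(* In \bar R, 0 * +oo = 0, so the endpoints t = 0, 1 impose nothing; the sum
   -oo + +oo (equal to -oo in the library) never occurs for proper phi. *)
Definition econvex phi := forall (x y : X) (t : R), 0 <= t <= 1 ->
  (phi (t *: x + (1 - t) *: y)%R <= t%:E * phi x + (1 - t)%:E * phi y)%E.

Definition proper phi :=
  (forall x, (-oo < phi x)%E) /\ (exists x, (phi x < +oo)%E).

(* Equal to -oo where there is no admissible minorant. *)
Definition conv_env g (x : X) : \bar R :=
  ereal_sup [set phi x | phi in
    [set phi | [/\ econvex phi, proper phi, lower_semicontinuous phi &
                   forall z, (phi z <= (g z)%:E)%E]]].

End ConvexEnvelope.

(* A real Hilbert space is a complete normed space X over R together with a
   dot product ip : {dot X for idfun} such that ip x x = `|x| ^+ 2. *)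
Section Hilbert.
Context {R : realType} {X : completeNormedModType R}.
Variable ip : {dot X for (@idfun R)}.

(* The Riesz representative of the differential of F at x; it exists and is
   unique when F is differentiable at x. *)
Definition grad (F : X -> R) (x : X) : X :=
  xget 0 [set v | forall h, 'd F x h = ip v h].

Definition C11 (F : X -> R) :=
  (forall x, differentiable F x) /\ lipschitz (grad F).

(* The least Lipschitz constant, +oo if u is not Lipschitz. The condition
   0 <= L matters only when X is trivial. *)
Definition Lip (u : X -> X) : \bar R :=
  ereal_inf [set L%:E | L in [set L : R | 0 <= L /\ L.-lipschitz u]].

(* f and G are total functions of which only the values on E are used. *)
Variables (E : set X) (f : X -> R) (G : X -> X) (M : R).

Definition W11 := forall x y, E x -> E y ->
  f y <= f x + 2^-1 * ip (G x + G y) (y - x) + M / 4 * `|x - y| ^+ 2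
         - (4 * M)^-1 * `|G x - G y| ^+ 2.

Definition paraboloids (x : X) : set R :=
  [set f y + ip (G y) (x - y) + M / 2 * `|x - y| ^+ 2 | y in E].

Definition gfun (x : X) : R := inf (paraboloids x) + M / 2 * `|x| ^+ 2.

Definition Fext (x : X) : R :=
  fine (conv_env gfun x) - M / 2 * `|x| ^+ 2.

End Hilbert.

(* Main.v *)
Require Import Defs.
From HB Require Import structures.
From mathcomp Require Import all_boot all_order all_algebra sesquilinear.
From mathcomp Require Import all_classical all_reals all_analysis.
From mathcomp Require Import ring lra.
Import Order.TTheory GRing.Theory Num.Theory.
Import numFieldNormedType.Exports.

Set Implicit Arguments.
Unset Strict Implicit.
Unset Printing Implicit Defensive.

Local Open Scope classical_set_scope.
Local Open Scope ring_scope.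

(** Write q for M / 2 * `|.| ^+ 2.  Completing a square shows that the
inequality of W11 for a pair of points says exactly that the downward
paraboloid of curvature M attached to one point lies below the upward
paraboloid attached to the other (separation).  After adding q the upward
paraboloids have infimum g, and the downward ones become affine functions
below g, hence below the envelope c of g.  Both families pass through
f + q with slope G + M *: id on E, so c is squeezed there, and F = c - q takes
the values f and has the gradients G on E.

The regularity of F comes from c being convex while c - 2 q is concave.  The
function g - 2 q is an infimum of affine functions, hence concave, and the
envelope inherits this without being described by convex combinations: for
nonnegative weights p1, p2 of sum 1 and shifts with p1 *: k1 + p2 *: k2 = 0,
the function p1 * c (x + k1) + p2 * c (x + k2) minus the quadratic error is
convex, lower semicontinuous and below g, hence below c
(fine_conv_env_semiconcave).  At each point the one-sided directional
derivative of c is then sublinear and odd, so linear; it is bounded because c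
lies below an upward paraboloid, so it is represented by a vector (riesz), and
c lies between the resulting affine function and that function plus
M * `|.| ^+ 2 (convex_semiconcave_gradient).  Thus F stays within
M / 2 * `|h| ^+ 2 of its first-order expansion everywhere, which gives
differentiability; reading separation backwards turns these bounds into the
inequality of W11 for (F, grad F), and adding that inequality to the one with
the points exchanged gives the Lipschitz constant M
(parabola_bounds_lipschitz).

For a competitor H, the first-order Taylor estimate puts H below every upward
paraboloid, so H + q <= g, and gives H + q an affine support at every point, so
it is convex and lower semicontinuous.  Therefore H + q <= c. *)

(** * Passing to the limit in scalar inequalities *)

Section Scalars.
Context {R : realType}.

Lemma le0_of_le_eps (a b : R) : (forall e : R, 0 < e -> a <= e * b) -> a <= 0.
Proof.
move=> ab; rewrite leNgt; apply/negP => a0.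
have b0 : 0 < b by have := ab 1 ltr01; rewrite mul1r; apply: lt_le_trans.
have := ab (a / (2 * b)) _.
rewrite (_ : a / (2 * b) * b = a / 2); last by field; rewrite gt_eqF.
move=> h; have : a <= a / 2 by apply: h; rewrite divr_gt0 ?mulr_gt0.
by lra.
Qed.

End Scalars.

(** * Convex envelopes *)

Section Envelope.
Context {R : realType} {X : normedModType R}.
Implicit Types (x y z h : X).

Definition real_convex (c : X -> R) := forall x y (t : R), 0 <= t <= 1 ->
  c (t *: x + (1 - t) *: y) <= t * c x + (1 - t) * c y.

(** Centred form of lower semicontinuity: it passes to translates and to
nonnegative combinations with no reference to neighbourhoods. *)
Definition real_lsc (c : X -> R) := forall x (e : R), 0 < e ->
  exists2 d : R, 0 < d & forall h, `|h| < d -> c x - e < c (x + h).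

(** Concavity of c - M * `|.| ^+ 2, tested at the three collinear points
x - e *: h, x, x + h, of which x is the mean with weights 1 and e; the division
by 1 + e is cleared. *)
Definition semiconcave (M : R) (c : X -> R) := forall x h (e : R), 0 < e ->
  e * c (x + h) + c (x - e *: h) <= (1 + e) * c x + M * e * (1 + e) * `|h| ^+ 2.

Lemma conv_env_le (g : X -> R) x : (conv_env g x <= (g x)%:E)%E.
Proof. by apply: ge_ereal_sup => _ [phi [_ _ _ phig] <-]. Qed.

Lemma le_conv_env (g phi : X -> R) : real_convex phi -> real_lsc phi ->
  (forall x, phi x <= g x) -> forall x, ((phi x)%:E <= conv_env g x)%E.
Proof.
move=> phi_convex phi_lsc phig x; apply: ereal_sup_ubound.
exists (EFin \o phi) => //; split.
- by move=> y z t t01; rewrite /= -!EFinM -EFinD lee_fin; exact: phi_convex.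
- by split=> [y|]; [exact: ltNyr|exists x; exact: ltry].
- move=> y a; rewrite /= lte_fin -subr_gt0 => /(phi_lsc y)[d d0 phid].
  exists (ball y d); first exact: nbhsx_ballx.
  move=> z; rewrite -ball_normE /ball_ /= distrC => /phid.
  by rewrite subKr subrKC lte_fin.
- by move=> z; rewrite lee_fin.
Qed.

(** One real-valued admissible minorant phi makes the envelope finite, so that
it can be handled as the real function c. *)
Section FiniteEnvelope.
Variables (g phi : X -> R).
Hypotheses (phi_convex : real_convex phi) (phi_lsc : real_lsc phi).
Hypothesis phig : forall x, phi x <= g x.

Lemma conv_env_fin_num x : conv_env g x \is a fin_num.
Proof.
rewrite fin_numE -ltNye -ltey; apply/andP; split.
  exact: lt_le_trans (ltNyr _) (le_conv_env phi_convex phi_lsc phig x).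
exact: le_lt_trans (conv_env_le g x) (ltry _).
Qed.

Let c x := fine (conv_env g x).

Lemma conv_envE x : (c x)%:E = conv_env g x.
Proof. exact: fineK (conv_env_fin_num x). Qed.

Lemma fine_conv_env_le x : c x <= g x.
Proof. by rewrite -lee_fin conv_envE conv_env_le. Qed.

Lemma le_fine_conv_env (psi : X -> R) : real_convex psi -> real_lsc psi ->
  (forall x, psi x <= g x) -> forall x, psi x <= c x.
Proof.
move=> psi_convex psi_lsc psig x.
by rewrite -lee_fin conv_envE; exact: le_conv_env.
Qed.

Lemma fine_conv_env_convex : real_convex c.
Proof.
move=> x y t t01; rewrite -lee_fin conv_envE EFinD !EFinM.
apply: ge_ereal_sup => _ [psi [psi_convex psi_proper psi_lsc psig] <-].
have /andP[t0 t1] := t01.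
apply: le_trans (psi_convex x y t t01) _.
by rewrite leeD // lee_wpmul2l ?lee_fin ?subr_ge0 // conv_envE;
  apply: ereal_sup_ubound; exists psi.
Qed.

Lemma fine_conv_env_lsc : real_lsc c.
Proof.
move=> x e e0.
have : ((c x - e)%:E < conv_env g x)%E.
  by rewrite -conv_envE lte_fin ltrBlDr ltrDl.
move=> /ereal_sup_gt[_ [psi psiP <-]] /= xe.
have [_ _ psi_lsc _] := psiP.
have [V /nbhs_ballP[d d0 dV] Ve] := psi_lsc x _ xe.
exists d => // h hd.
rewrite -lte_fin conv_envE; apply: lt_le_trans (Ve (x + h) _) _.
  by apply: dV; rewrite -ball_normE /ball_ /= opprD addNKr normrN.
by apply: ereal_sup_ubound; exists psi.
Qed.

(** The weighted mean of two translates of c, lowered by the curvature error,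
is itself an admissible minorant of g, so the maximality of c finishes. *)
Lemma fine_conv_env_semiconcave (M : R) : semiconcave M g -> semiconcave M c.
Proof.
move=> gM x h e e0; have e1 : 0 < 1 + e by rewrite addr_gt0.
pose psi y := (1 + e)^-1 * (e * c (y + h) + c (y - e *: h)) - M * e * `|h| ^+ 2.
suff psic : psi x <= c x.
  move: psic; rewrite /psi lerBlDr ler_pdivrMl // mulrDr.
  move: (c _) (c _) (c _) (`|h| ^+ 2) => a b k n; lra.
apply: le_fine_conv_env x => [y z t t01|y d d0|y].
- rewrite /psi.
  have shift (k : X) :
      t *: y + (1 - t) *: z + k = t *: (y + k) + (1 - t) *: (z + k).
    by rewrite !scalerDr addrACA -scalerDl (addrC t) subrK scale1r.
  have := fine_conv_env_convex (y + h) (z + h) t01.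
  have := fine_conv_env_convex (y - e *: h) (z - e *: h) t01.
  rewrite -!shift.
  move: (c _) (c _) (c _) (c _) (c _) (c _) (`|h| ^+ 2).
  move=> a6 a5 a4 a3 a2 a1 n h1 h2.
  rewrite -subr_ge0 (_ : _ - _ = (1 + e)^-1 *
   ((t * a2 + (1 - t) * a3 - a1) + e * (t * a5 + (1 - t) * a6 - a4))).
    rewrite mulr_ge0 ?invr_ge0 ?(ltW e1) //.
    by rewrite addr_ge0 ?mulr_ge0 ?subr_ge0 // ltW.
  by ring.
- have [d1 d10 cd1] := fine_conv_env_lsc (y + h) d0.
  have [d2 d20 cd2] := fine_conv_env_lsc (y - e *: h) d0.
  exists (Num.min d1 d2); first by rewrite lt_min d10.
  move=> k; rewrite lt_min => /andP[/cd1 + /cd2].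
  (* The two drops of at most d are averaged, so psi also drops by less than d. *)
  rewrite (addrAC y) [y - _ + k]addrAC /psi.
  move: (c _) (c _) (c _) (c _) (`|h| ^+ 2) => a4 a3 a2 a1 n h1 h2.
  rewrite -subr_gt0 (_ : _ - _ = (1 + e)^-1 *
   ((a4 - (a3 - d)) + e * (a2 - (a1 - d)))).
    by rewrite mulr_gt0 ?invr_gt0 // addr_gt0 ?mulr_gt0 ?subr_gt0.
  by field; rewrite gt_eqF.
- rewrite /psi lerBlDr ler_pdivrMl //.
  have := gM y h e e0.
  have := fine_conv_env_le (y + h); have := fine_conv_env_le (y - e *: h).
  move: (c _) (c _) (g _) (g _) (g _) (`|h| ^+ 2) => c2 c1 g3 g2 g1 n h1 h2.
  have : e * c2 <= e * g2 by rewrite ler_pM2l.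
  lra.
Qed.

End FiniteEnvelope.

End Envelope.

(** * Inner product algebra *)

Section HilbertSpace.
Context {R : realType} {X : completeNormedModType R}.
Variable ip : {dot X for (@idfun R)}.
Hypothesis ip_norm : forall x : X, ip x x = `|x| ^+ 2.
Implicit Types (x y z h v : X).

Lemma ipC x y : ip x y = ip y x.
Proof. by rewrite hermC expr0 mul1r. Qed.
Lemma ipDl x y z : ip (x + y) z = ip x z + ip y z.
Proof. exact: linearDl. Qed.
Lemma ipDr x y z : ip z (x + y) = ip z x + ip z y.
Proof. exact: linearDr. Qed.
Lemma ipNl x z : ip (- x) z = - ip x z.
Proof. exact: linearNl. Qed.
Lemma ipNr x z : ip z (- x) = - ip z x.
Proof. exact: linearNr. Qed.
Lemma ipZl (a : R) x z : ip (a *: x) z = a * ip x z.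
Proof. exact: linearZl_LR. Qed.
Lemma ipZr (a : R) x z : ip z (a *: x) = a * ip z x.
Proof. exact: linearZr_LR. Qed.
Lemma ip0l z : ip 0 z = 0.
Proof. exact: linear0l. Qed.
Lemma ip0r z : ip z 0 = 0.
Proof. exact: linear0r. Qed.

Definition ipE := (ip0l, ip0r, ipDl, ipDr, ipNl, ipNr, ipZl, ipZr).

(** The vector whose norm is used is `|y| ^+ 2 times the component of x orthogonal
to y, which avoids a division. *)
Lemma cauchy_schwarz x y : `|ip x y| <= `|x| * `|y|.
Proof.
have [->|y0] := eqVneq y 0; first by rewrite ip0r !normr0 mulr0.
have yy : 0 < `|y| ^+ 2 by rewrite exprn_gt0 // normr_gt0.
rewrite -ler_sqr ?nnegrE ?mulr_ge0 // exprMn real_normK ?num_real //.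
have := sqr_ge0 `|ip y y *: x - ip x y *: y|.
rewrite -!ip_norm !ipE (ipC y x) in yy *.
nra.
Qed.

Lemma ler_ip x y : ip x y <= `|x| * `|y|.
Proof. exact: le_trans (ler_norm _) (cauchy_schwarz x y). Qed.

(** * Riesz representation *)

(** A d ^+ 2-minimizer u of J almost represents l: moving from u by t *: h
changes J by 2 * t * (ip u h - l h) + t ^+ 2 * `|h| ^+ 2, whose minimum over t
is - (ip u h - l h) ^+ 2 / `|h| ^+ 2 and cannot be below - d ^+ 2. *)
Lemma approx_riesz (l : X -> R) (K : R) :
  (forall x y, l (x + y) = l x + l y) ->
  (forall (a : R) x, l (a *: x) = a * l x) ->
  (forall x, l x <= K * `|x|) ->
  forall d : R, 0 < d -> exists u : X, forall h, `|l h - ip u h| <= d * `|h|.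
Proof.
move=> lD lZ lK d d0.
pose J u : R := `|u| ^+ 2 - 2 * l u.
have infJ : has_inf (range J).
  split; first by exists (J 0), 0.
  exists (- (K ^+ 2)) => _ [u _ <-]; rewrite /J.
  by have := lK u; have := sqr_ge0 (`|u| - K); rewrite sqrrB; lra.
have [_ [u _ <-] uJ] := inf_adherent (exprn_gt0 2 d0) infJ.
exists u => h; rewrite distrC; have [->|h0] := eqVneq h 0.
  by have := lZ 0 0; rewrite scale0r mul0r => ->; rewrite ip0r subrr !normr0 mulr0.
rewrite -ler_sqr ?nnegrE ?mulr_ge0 ?(ltW d0) // real_normK ?num_real //.
have hh : 0 < `|h| ^+ 2 by rewrite exprn_gt0 // normr_gt0.
set b := ip u h - l h.
(* The minimizing t of the expansion of J along h. *)
have := ge_inf infJ.2 (imageT J (u + (- (b / `|h| ^+ 2)) *: h)).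
rewrite -(lerD2r (d ^+ 2)) => /(lt_le_trans uJ).
rewrite /J lD lZ -!ip_norm !ipE (ipC h u) !ip_norm.
move=> key.
suff bd : b ^+ 2 / `|h| ^+ 2 <= d ^+ 2.
  by rewrite exprMn; move: bd; rewrite ler_pdivrMr.
move: key.
have -> : l h = ip u h - b by rewrite /b; ring.
suff -> : `|u| ^+ 2 + - (b / `|h| ^+ 2) * ip u h +
  (- (b / `|h| ^+ 2) * ip u h + - (b / `|h| ^+ 2) * (- (b / `|h| ^+ 2) * `|h| ^+ 2)) -
  2 * (l u + - (b / `|h| ^+ 2) * (ip u h - b)) =
   `|u| ^+ 2 - 2 * l u - b ^+ 2 / `|h| ^+ 2.
  by lra.
by field; rewrite gt_eqF // normr_gt0.
Qed.

(** Two approximate representers of the same l are close, as is seen by testing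
on their difference.  So the 1 / n.+1-representers form a Cauchy sequence, and
completeness provides the exact one. *)
Lemma riesz (l : X -> R) (K : R) :
  (forall x y, l (x + y) = l x + l y) ->
  (forall (a : R) x, l (a *: x) = a * l x) ->
  (forall x, l x <= K * `|x|) ->
  exists v, forall h, l h = ip v h.
Proof.
move=> lD lZ lK.
pose e_ n : R := n.+1%:R^-1.
have e_ge0 n : 0 <= e_ n by rewrite invr_ge0.
have e_lt (e : R) : 0 < e -> \forall n \near \oo, e_ n < e.
  by move=> e0; exact: near_infty_natSinv_lt (PosNum e0).
have /choice[w w_l] : forall n : nat,
    exists u : X, forall h : X, `|l h - ip u h| <= e_ n * `|h|.
  by move=> n; apply: approx_riesz lD lZ lK _ _; rewrite invr_gt0.
have w_dist n m : `|w n - w m| <= e_ n + e_ m.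
  have [->|wnm] := eqVneq (w n) (w m); first by rewrite subrr normr0 addr_ge0.
  suff : `|w n - w m| ^+ 2 <= (e_ n + e_ m) * `|w n - w m|.
    by rewrite expr2 ler_pM2r // normr_gt0 subr_eq0.
  have := w_l n (w n - w m); have := w_l m (w n - w m).
  rewrite -ip_norm ipDl ipNl !ler_norml => /andP[? ?] /andP[? ?]; lra.
have [v wv] : exists v, w @ \oo --> v.
  apply/cvg_ex/cauchy_cvgP/cauchy_exP => e e0.
  have e2 : 0 < e / 2 by rewrite divr_gt0.
  have [N _ eN] := e_lt _ e2.
  exists (w N), N => //= m Nm; rewrite -ball_normE /ball_ /=.
  apply: le_lt_trans (w_dist N m) _.
  by rewrite [ltRHS]splitr ltrD // eN //=.
exists v => h; apply/subr0_eq/normr0_eq0/le_anti; rewrite normr_ge0 andbT.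
apply: (@le0_of_le_eps _ _ (2 * `|h|)) => e e0.
have /cvgr_dist_lt/(_ _ e0) wve := wv.
near \oo => n.
have vn : `|v - w n| < e by near: n.
have ne : e_ n < e by near: n; exact: e_lt.
have -> : l h - ip v h = (l h - ip (w n) h) - ip (v - w n) h.
  by rewrite ipDl ipNl; ring.
apply: le_trans (ler_normB _ _) _.
have := cauchy_schwarz (v - w n) h; have := w_l n h.
have := normr_ge0 h; nra.
Unshelve. all: by end_near. Qed.

(** * Gradients *)

(** The vector chosen in the definition of grad exists because the differential
is a bounded linear form. *)
Lemma gradE (F : X -> R) x : differentiable F x ->
  forall h, 'd F x h = ip (grad ip F x) h.
Proof.
move=> dF; rewrite /grad; case: xgetP => [v _ //|].
have /linear_bounded_continuous/linear_boundedP : continuous ('d F x).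
  exact: diff_continuous.
move=> /pinfty_ex_gt0[K K0 dK] nv; exfalso.
have [v vP] : exists v, forall h, 'd F x h = ip v h.
  apply: (@riesz _ K) => [y z|a y|y].
  - exact: linearD.
  - exact: linearZ.
  - exact: le_trans (ler_norm _) (dK y).
exact: nv v vP.
Qed.

Lemma grad_eq (F : X -> R) x v : (forall h, 'd F x h = ip v h) ->
  grad ip F x = v.
Proof.
move=> vF; rewrite /grad; case: xgetP => [w _ wF|/(_ v)//].
have /eqP : `|w - v| ^+ 2 = 0.
  by rewrite -ip_norm ipDl ipNl -wF -vF subrr.
by rewrite sqrf_eq0 normr_eq0 subr_eq0 => /eqP.
Qed.

(** A copy of ip v whose linearity is declared for the scaling *:%R of R as a
normed module, the one that differentials use; the linearity attached to ip is
for the multiplication *%R. *)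
Definition ipl v := ip v : X -> R.
Section IpLinear.
Variable v : X.
Lemma ip_linear_subproof : linear (ipl v : X -> R).
Proof. by move=> a x y; rewrite /ipl ipDr ipZr. Qed.
HB.instance Definition _ :=
  @GRing.isLinear.Build R X R *:%R (ipl v) ip_linear_subproof.
End IpLinear.

(** The way every gradient of F is computed below: a quadratic error is
negligible to first order, and it pins down the vector v. *)
Lemma diff_of_quadratic_bound (F : X -> R) x v (K : R) : 0 <= K ->
  (forall h, `|F (x + h) - F x - ip v h| <= K * `|h| ^+ 2) ->
  differentiable F x /\ grad ip F x = v.
Proof.
move=> K0 FK.
have cv : continuous (ipl v : {linear X -> R}).
  apply/linear_bounded_continuous/linear_boundedP; near=> r => y.
  apply: le_trans (cauchy_schwarz v y) _.
  by apply: ler_wpM2r => //; near: r; exact: nbhs_pinfty_ge.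
have Fo : F \o shift x = cst (F x) + (ipl v : {linear X -> R}) +o_ 0 id.
  apply/eqaddoP => e e0; near=> h => /=.
  have -> : (F \o shift x - (cst (F x) + (ipl v : {linear X -> R}))) h =
      F (x + h) - F x - ip v h.
    by rewrite !fctE /= /shift /ipl (addrC h) opprD addrA.
  apply: le_trans (FK h) _; rewrite expr2 mulrA ler_wpM2r //.
  have hK : (K + 1) * `|h| <= e.
    rewrite -ler_pdivlMl ?ltr_wpDl // ltW //; near: h.
    by apply: cvgr0_norm_lt; [exact: cvg_id|rewrite mulr_gt0 // invr_gt0 ltr_wpDl].
  by apply: le_trans hK; rewrite ler_wpM2r // lerDl.
have dF := diff_unique cv Fo.
split; last by apply: grad_eq => h; rewrite dF.
by apply/diff_locallyP; rewrite dF; split.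
Unshelve. all: by end_near. Qed.

(** * Paraboloids, first-order bounds and Lipschitz gradients *)

(** The difference of an upward and a downward paraboloid of the same curvature
is M * `|z| ^+ 2 plus an affine function of z; the square is completed around
the minimizer.  The constant left over is the slack in the inequality of
W11. *)
Lemma separation_gap (M : R) (a b : R) x y z v w : 0 < M ->
  (a + ip v (z - x) + M / 2 * `|z - x| ^+ 2) -
  (b + ip w (z - y) - M / 2 * `|z - y| ^+ 2) =
  (a + 2^-1 * ip (v + w) (y - x) + M / 4 * `|x - y| ^+ 2
     - (4 * M)^-1 * `|v - w| ^+ 2 - b)
  + M * `|z - 2^-1 *: (x + y) + (2 * M)^-1 *: (v - w)| ^+ 2.
Proof.
move=> M0; rewrite -!ip_norm !ipE (ipC y x) (ipC z x) (ipC z y).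
rewrite (ipC w v) !(ipC _ v) !(ipC _ w).
by field; rewrite gt_eqF.
Qed.

(** The geometric meaning of W11, used in both directions: from left to right
for the given data, from right to left for the extension. *)
Lemma separation (M : R) (a b : R) x y v w : 0 < M ->
  b <= a + 2^-1 * ip (v + w) (y - x) + M / 4 * `|x - y| ^+ 2
     - (4 * M)^-1 * `|v - w| ^+ 2 <->
  forall z, b + ip w (z - y) - M / 2 * `|z - y| ^+ 2 <=
    a + ip v (z - x) + M / 2 * `|z - x| ^+ 2.
Proof.
move=> M0; split=> [ba z|ba].
  rewrite -subr_ge0 separation_gap // addr_ge0 ?subr_ge0 //.
  by rewrite mulr_ge0 ?sqr_ge0 // ltW.
set m := 2^-1 *: (x + y); set d := (2 * M)^-1 *: (v - w).
(* The minimizer of the gap. *)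
have := ba (m - d).
rewrite -subr_ge0 separation_gap //.
rewrite -/m -/d (_ : m - d - m + d = 0); last by rewrite addrAC subrK subrr.
by rewrite normr0 expr0n mulr0 addr0 subr_ge0.
Qed.

Definition parabola_bounds (M : R) (F : X -> R) (D : X -> X) :=
  forall x h, `|F (x + h) - F x - ip (D x) h| <= M / 2 * `|h| ^+ 2.

(** The bounds at x and at y trap F between the downward paraboloid of one point
and the upward one of the other.  By separation this is the inequality of W11,
and the sum of the two inequalities for (x, y) and (y, x) keeps only
`|x - y| ^+ 2 and `|D x - D y| ^+ 2.  Estimating the increment of D directly
from the bounds would lose a constant factor. *)
Lemma parabola_bounds_lipschitz (M : R) (F : X -> R) (D : X -> X) : 0 < M ->
  parabola_bounds M F D -> forall x y, `|D x - D y| <= M * `|x - y|.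
Proof.
move=> M0 FD.
have key x y : F y <= F x + 2^-1 * ip (D x + D y) (y - x)
    + M / 4 * `|x - y| ^+ 2 - (4 * M)^-1 * `|D x - D y| ^+ 2.
  apply/separation => // z.
  have := FD x (z - x); have := FD y (z - y).
  by rewrite !ler_norml !subrKC => /andP[? ?] /andP[? ?]; lra.
move=> x y; rewrite -ler_sqr ?nnegrE ?mulr_ge0 ?(ltW M0) // exprMn.
have := key x y; have := key y x.
rewrite (distrC y x) (distrC (D y)).
rewrite (_ : ip (D y + D x) (x - y) = - ip (D x + D y) (y - x)); last first.
  by rewrite -ipNr opprB (addrC (D y)).
move=> k1 k2.
have : (2 * M)^-1 * `|D x - D y| ^+ 2 <= M / 2 * `|x - y| ^+ 2.
  rewrite (_ : (2 * M)^-1 = (4 * M)^-1 + (4 * M)^-1).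
    by rewrite mulrDl; lra.
  by field; rewrite gt_eqF.
rewrite ler_pdivrMl ?mulr_gt0 //; lra.
Qed.

Lemma Lip_le (M : R) (u : X -> X) : 0 <= M ->
  (forall x y, `|u x - u y| <= M * `|x - y|) -> (Lip u <= M%:E)%E.
Proof.
move=> M0 uM; apply: ereal_inf_lbound; exists M => //; split => //.
by case=> x y _; exact: uM.
Qed.

(** The infimum defining Lip is attained: the inequality holds with M + e for
every positive e. *)
Lemma le_Lip (M : R) (u : X -> X) : (Lip u <= M%:E)%E ->
  forall x y, `|u x - u y| <= M * `|x - y|.
Proof.
move=> uM x y; rewrite -subr_le0.
apply: (@le0_of_le_eps _ _ `|x - y|) => e e0.
have : (Lip u < (M + e)%:E)%E by apply: le_lt_trans uM _; rewrite lte_fin ltrDl.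
move=> /ereal_inf_lt[_ [L [L0 uL] <-]]; rewrite lte_fin => LM.
have := uL (x, y) (conj I I) => /= /le_trans h.
by rewrite lerBlDl -mulrDl; apply: h; rewrite ler_wpM2r // ltW.
Qed.

(** The mean value theorem for phi minus a parabola of curvature K; the choices
K = L and K = - L give the two halves. *)
Lemma taylor1_le (phi dphi : R -> R) (L : R) :
  (forall t : R, is_derive t (1 : R) phi (dphi t)) ->
  (forall t, 0 <= t <= 1 -> `|dphi t - dphi 0| <= L * t) ->
  `|phi 1 - phi 0 - dphi 0| <= L / 2.
Proof.
move=> phiD dphiL.
have mvt K : exists2 t, 0 <= t <= 1 &
    phi 1 - phi 0 - dphi 0 - K / 2 = dphi t - dphi 0 - K * t.
  pose psi t : R := phi t - t * dphi 0 - K / 2 * t ^+ 2.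
  have psiD (t : R) : is_derive t (1 : R) psi (dphi t - dphi 0 - K * t).
    by apply: is_derive_eq; rewrite /GRing.scale /=; field.
  have [t] := @MVT_segment _ psi _ 0 1 ler01 (fun t _ => psiD t)
    (derivable_within_continuous (fun t _ => @ex_derive _ _ _ _ _ _ _ (psiD t))).
  rewrite in_itv /= subr0 mulr1 => t01 psi10; exists t => //.
  by rewrite -psi10 /psi; ring.
have [t /[dup] t01 /dphiL + tE] := mvt L.
have [s /[dup] s01 /dphiL + sE] := mvt (- L).
by rewrite !ler_norml => /andP[? ?] /andP[? ?]; apply/andP; split; lra.
Qed.

(** One-variable Taylor estimate along the segment from x to x + h. *)
Lemma lipschitz_grad_parabola_bounds (M : R) (H : X -> R) (D : X -> X) :
  (forall x, differentiable H x) -> (forall x h, 'd H x h = ip (D x) h) ->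
  (forall x y, `|D x - D y| <= M * `|x - y|) ->
  parabola_bounds M H D.
Proof.
move=> dH HD DM x h; rewrite mulrAC.
have := @taylor1_le (fun t => H (x + t *: h))
  (fun t => ip (D (x + t *: h)) h) (M * `|h| ^+ 2).
rewrite scale1r scale0r addr0; apply=> [t|t /andP[t0 _]].
  (* The difference quotients of the restriction to the line are those of H in
     the direction h. *)
  have Hq : (fun k : R => k^-1 *: (((fun t : R => H (x + t *: h)) \o shift t)
       (k *: (1 : R)) - H (x + t *: h))) =
      (fun k : R => k^-1 *: ((H \o shift (x + t *: h)) (k *: h) - H (x + t *: h))).
    apply/funext => k /=; congr (_ *: (H _ - _)).
    by rewrite /shift /= scalerDl addrCA [k *: 1]mulr1 addrC.
  split; first by rewrite /derivable Hq; exact: (diff_derivable (dH _)).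
  by rewrite -HD -deriveE // /derive Hq.
rewrite -ipNl -ipDl; apply: le_trans (cauchy_schwarz _ _) _.
rewrite mulrAC expr2 mulrA ler_wpM2r //; apply: le_trans (DM _ _) _.
by rewrite addrAC subrr add0r normrZ (ger0_norm t0) mulrA.
Qed.

(** * Affine supports of convex functions *)

(** A function with an affine support at every point is the supremum of these
supports. *)
Lemma affine_support_convex_lsc (c : X -> R) (D : X -> X) :
  (forall x h, c x + ip (D x) h <= c (x + h)) -> real_convex c /\ real_lsc c.
Proof.
move=> cD; split=> [x y t /andP[t0 t1]|x e e0].
  set w := t *: x + (1 - t) *: y.
  have := cD w (x - w); have := cD w (y - w); rewrite !subrKC.
  have : t * ip (D w) (x - w) + (1 - t) * ip (D w) (y - w) = 0.
    rewrite -!ipZr -ipDr (_ : _ + _ = 0) ?ip0r // !scalerBr addrACA -opprD.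
    by rewrite -scalerDl (addrC t) subrK scale1r subrr.
  move: (ip _ _) (ip _ _) (c w) (c x) (c y) => b a cw cx cy ab0 cy_ge cx_ge.
  suff : 0 <= t * (cx - (cw + a)) + (1 - t) * (cy - (cw + b)) by lra.
  by rewrite addr_ge0 // mulr_ge0 // subr_ge0.
exists (e / (`|D x| + 1)); first by rewrite divr_gt0 // ltr_wpDl.
move=> h; rewrite ltr_pdivlMr ?ltr_wpDl // => he.
have := cD x h; have := cauchy_schwarz (D x) h.
rewrite ler_norml => /andP[+ _]; have := normr_ge0 h.
move: he; rewrite mulrDr mulr1 (mulrC `|h|); lra.
Qed.

(** The directional derivative l of c at x is defined as the infimum of the
difference quotients rather than as their limit: this needs no monotonicity,
and convexity enters only through a_quotD. *)
Section ConvexGradient.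
Variables (M B : R) (c : X -> R) (x : X).
Hypotheses (c_convex : real_convex c) (c_semi : semiconcave M c).
Hypothesis c_bounded : forall h, `|h| <= 1 -> c (x + h) <= B.

Let a h := c (x + h) - c x.
Let l h := inf [set a (s *: h) / s | s in [set s : R | 0 < s]].

Let a0 : a 0 = 0. Proof. by rewrite /a addr0 subrr. Qed.

Let a_semi h (e : R) : 0 < e ->
  e * a h + a (- e *: h) <= M * e * (1 + e) * `|h| ^+ 2.
Proof.
by move=> e0; have := c_semi x h e0; rewrite /a scaleNr; lra.
Qed.

(** The quotients with steps s and t bound the quotient of the sum with half the
harmonic mean s * t / (s + t) as its step: with weights t / (s + t) and
s / (s + t), the mean of x + s *: h and x + t *: k is
x + (s * t / (s + t)) *: (h + k). *)
Let a_quotD h k (s t : R) : 0 < s -> 0 < t ->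
  a ((s * t / (s + t)) *: (h + k)) / (s * t / (s + t)) <=
    a (s *: h) / s + a (t *: k) / t.
Proof.
move=> s0 t0; have st0 : 0 < s + t by rewrite addr_gt0.
have r0 : 0 < s * t / (s + t) by rewrite divr_gt0 ?mulr_gt0.
have w01 : 0 <= t / (s + t) <= 1.
  by rewrite divr_ge0 ?(ltW t0) ?(ltW st0) //= ler_pdivrMr // mul1r lerDr ltW.
have := c_convex (x + s *: h) (x + t *: k) w01.
have -> : t / (s + t) *: (x + s *: h) + (1 - t / (s + t)) *: (x + t *: k) =
    x + (s * t / (s + t)) *: (h + k).
  rewrite !scalerDr addrACA -scalerDl (addrC (t / _)) subrK scale1r !scalerA.
  by congr (_ + (_ *: _ + _ *: _)); field; rewrite gt_eqF.
rewrite ler_pdivrMr // /a.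
move: (c _) (c _) (c _) (c _) => c4 c3 c2 c1 h1.
rewrite (_ : _ * (s * t / (s + t)) =
  t / (s + t) * c2 + (1 - t / (s + t)) * c3 - c4); first by lra.
by field; rewrite !gt_eqF.
Qed.

Let l_has_inf h : has_inf [set a (s *: h) / s | s in [set s : R | 0 < s]].
Proof.
split; first by exists (a (1 *: h) / 1), 1 => //=.
exists (- a (- h)) => _ [s /= s0 <-].
have := a_quotD h (- h) s0 ltr01.
by rewrite subrr scaler0 a0 mul0r scale1r divr1; lra.
Qed.

Let l_le h (s : R) : 0 < s -> l h <= a (s *: h) / s.
Proof. by move=> s0; apply: (ge_inf (l_has_inf h).2); exists s. Qed.

Let le_l h (b : R) : (forall s : R, 0 < s -> b <= a (s *: h) / s) -> b <= l h.
Proof.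
move=> bh; apply: lb_le_inf (l_has_inf h).1 _ => _ [s /= s0 <-]; exact: bh.
Qed.

Let l0 : l 0 = 0.
Proof.
apply/le_anti/andP; split.
  by have := l_le 0 ltr01; rewrite scaler0 a0 mul0r.
by apply: le_l => s s0; rewrite scaler0 a0 mul0r.
Qed.

Let l_sub h k : l (h + k) <= l h + l k.
Proof.
rewrite -lerBlDr; apply: le_l => s s0; rewrite lerBlDr -lerBlDl.
apply: le_l => t t0; rewrite lerBlDl; apply: le_trans (a_quotD h k s0 t0).
by apply: l_le; rewrite divr_gt0 ?mulr_gt0 ?addr_gt0.
Qed.

(** Semiconcavity with equal weights bounds the sum of the quotients along h and
- h by a multiple of the step, so c has no corner at x. *)
Let l_opp h : l (- h) = - l h.
Proof.
apply/le_anti/andP; split; last first.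
  by have := l_sub h (- h); rewrite subrr l0; lra.
rewrite -subr_le0 opprK; apply: (@le0_of_le_eps _ _ (M * 2 * `|h| ^+ 2)) => s s0.
have := a_semi (s *: h) ltr01; have := l_le h s0; have := l_le (- h) s0.
rewrite !ler_pdivlMr // normrZ gtr0_norm // exprMn scaleN1r scalerN mul1r.
by move=> ? ? ?; rewrite -(ler_pM2r s0); lra.
Qed.

Let lD h k : l (h + k) = l h + l k.
Proof.
apply/le_anti; rewrite l_sub /=.
by have := l_sub (h + k) (- k); rewrite addrK l_opp; lra.
Qed.

Let l_pos (r : R) h : 0 < r -> l (r *: h) = r * l h.
Proof.
have half (r' : R) k : 0 < r' -> l (r' *: k) <= r' * l k.
  move=> r0; rewrite -ler_pdivrMl //; apply: le_l => s s0.
  have := l_le (r' *: k) (divr_gt0 s0 r0).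
  rewrite scalerA divfK ?gt_eqF // ler_pdivrMl // => /le_trans; apply.
  by rewrite invf_div mulrCA.
move=> r0; apply/le_anti; rewrite half //=.
have := half r^-1 (r *: h); rewrite invr_gt0 => /(_ r0).
by rewrite scalerA mulVf ?gt_eqF // scale1r ler_pdivlMl.
Qed.

Let lZ (r : R) h : l (r *: h) = r * l h.
Proof.
have [r0|r0|->] := ltgtP r 0; last by rewrite scale0r l0 mul0r.
- by rewrite -[in LHS](opprK r) scaleNr l_opp l_pos ?oppr_gt0 // mulNr opprK.
- exact: l_pos.
Qed.

Let l_bound h : l h <= (B - c x) * `|h|.
Proof.
have [->|h0] := eqVneq h 0; first by rewrite l0 normr0 mulr0.
have nh : 0 < `|h| by rewrite normr_gt0.
have nh1 : 0 < `|h|^-1 by rewrite invr_gt0.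
apply: le_trans (l_le h nh1) _; rewrite invrK ler_pM2r // lerD2r.
by apply: c_bounded; rewrite normrZ gtr0_norm // mulVf // gt_eqF.
Qed.

(** Convexity puts the tangent below c.  For the upper bound, semiconcavity at
x - e *: h, x, x + h, with the lower bound used at x - e *: h, gives
M * (1 + e) * `|h| ^+ 2, and e tends to 0. *)
Lemma convex_semiconcave_gradient : exists v, forall h,
  0 <= c (x + h) - c x - ip v h <= M * `|h| ^+ 2.
Proof.
have [v vl] := riesz lD lZ l_bound.
have supp h : ip v h <= a h.
  by rewrite -vl; have := l_le h ltr01; rewrite scale1r divr1.
exists v => h; rewrite subr_ge0 supp /= -subr_le0.
apply: (@le0_of_le_eps _ _ (M * `|h| ^+ 2)) => e e0.
rewrite -(ler_pM2l e0) -/(a h).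
have := a_semi h e0; have := supp (- e *: h); rewrite ipZr.
move: (a _) (a h) (ip v h) (`|h| ^+ 2) => b d i n; lra.
Qed.

End ConvexGradient.

(** Subtracting M / 2 * `|.| ^+ 2 centres the one-sided bounds on c, so the
constant is halved and the bounds become two-sided. *)
Lemma sub_sqr_parabola_bounds (M : R) (c F : X -> R) (D : X -> X) :
  (forall x h, 0 <= c (x + h) - c x - ip (D x) h <= M * `|h| ^+ 2) ->
  (forall x, F x = c x - M / 2 * `|x| ^+ 2) ->
  parabola_bounds M F (fun x => D x - M *: x).
Proof.
move=> cD FE x h; rewrite !FE -!ip_norm !ipE (ipC h x).
have := cD x h; rewrite -ip_norm ler_norml.
move: (c _) (c _) (ip _ _) (ip _ _) (ip _ _) (ip _ _) => b1 b2 b3 b4 b5 b6 /andP[? ?].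
apply/andP; split; lra.
Qed.

(** The lower parabola at x becomes, once M / 2 * `|.| ^+ 2 is added, an affine
support with slope D x + M *: x. *)
Lemma parabola_bounds_add_sqr_convex_lsc (M : R) (H : X -> R) (D : X -> X) :
  parabola_bounds M H D ->
  real_convex (fun x => H x + M / 2 * `|x| ^+ 2) /\
  real_lsc (fun x => H x + M / 2 * `|x| ^+ 2).
Proof.
move=> HD.
apply: (affine_support_convex_lsc (D := fun x => D x + M *: x)) => x h.
have := HD x h; rewrite ler_norml => /andP[+ _].
rewrite -!ip_norm !ipE (ipC h x).
move: (H _) (H _) (ip _ _) (ip _ _) (ip _ _) (ip _ _) => b1 b2 b3 b4 b5 b6; lra.
Qed.

(** * The extension formula *)

Section Extension.
Variables (E : set X) (f : X -> R) (G : X -> X) (M : R).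
Hypotheses (E0 : E !=set0) (M0 : 0 < M) (fG : W11 ip E f G M).

Let g := gfun ip E f G M.
Let c x := fine (conv_env g x).
Let F := Fext ip E f G M.

(** The paraboloids attached to the points of E, both raised by
M / 2 * `|x| ^+ 2: this makes lower z affine and doubles the curvature of
upper y. *)
Let lower z x : R :=
  f z + ip (G z) (x - z) - M / 2 * `|x - z| ^+ 2 + M / 2 * `|x| ^+ 2.
Let upper y x : R :=
  f y + ip (G y) (x - y) + M / 2 * `|x - y| ^+ 2 + M / 2 * `|x| ^+ 2.

Let lower_le_upper y z x : E y -> E z -> lower z x <= upper y x.
Proof.
move=> Ey Ez; rewrite lerD2r.
exact: (separation (f y) (f z) y z (G y) (G z) M0).1 (fG Ey Ez) x.
Qed.

Lemma paraboloids_has_inf x : has_inf (paraboloids ip E f G M x).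
Proof.
have [z Ez] := E0; split.
  by exists (upper z x - M / 2 * `|x| ^+ 2), z => //; rewrite /upper addrK.
exists (lower z x - M / 2 * `|x| ^+ 2) => _ [y Ey <-].
by rewrite lerBlDr; exact: lower_le_upper.
Qed.

Let g_le y x : E y -> g x <= upper y x.
Proof.
move=> Ey; rewrite lerD2r; apply: (ge_inf (paraboloids_has_inf x).2).
by exists y.
Qed.

Let le_g (b : R) x : (forall y, E y -> b <= upper y x) -> b <= g x.
Proof.
move=> bu; rewrite -lerBlDr; apply: lb_le_inf (paraboloids_has_inf x).1 _.
by move=> _ [y Ey <-]; rewrite lerBlDr; exact: bu.
Qed.

Let lower_le_g z x : E z -> lower z x <= g x.
Proof. by move=> Ez; apply: le_g => y Ey; exact: lower_le_upper. Qed.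

Let lower_convex_lsc z : real_convex (lower z) /\ real_lsc (lower z).
Proof.
apply: (affine_support_convex_lsc (D := fun=> G z + M *: z)) => x h.
rewrite /lower -!ip_norm !ipE (ipC h x) (ipC z x) (ipC z h).
lra.
Qed.

(** Each upper y is quadratic with leading part M * `|x| ^+ 2, so it satisfies
semiconcavity with equality, and an infimum of such functions satisfies the
inequality. *)
Let g_semiconcave : semiconcave M g.
Proof.
move=> x h e e0; have e1 : 0 < 1 + e by rewrite addr_gt0.
rewrite -lerBlDr -ler_pdivrMl //; apply: le_g => y Ey.
rewrite ler_pdivrMl // lerBlDr.
have := g_le (x + h) Ey; have := g_le (x - e *: h) Ey.
rewrite -(ler_pM2l e0 (g (x + h))).
suff -> : (1 + e) * upper y x + M * e * (1 + e) * `|h| ^+ 2 =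
  e * upper y (x + h) + upper y (x - e *: h) by lra.
rewrite /upper -!ip_norm !ipE (ipC h x) (ipC y x) (ipC y h).
by field.
Qed.

Let c_le_g x : c x <= g x.
Proof.
have [z Ez] := E0; have [zc zl] := lower_convex_lsc z.
exact: (fine_conv_env_le zc zl (fun x => lower_le_g x Ez)).
Qed.

Let le_c (psi : X -> R) : real_convex psi -> real_lsc psi ->
  (forall x, psi x <= g x) -> forall x, psi x <= c x.
Proof.
have [z Ez] := E0; have [zc zl] := lower_convex_lsc z.
exact: (le_fine_conv_env zc zl (fun x => lower_le_g x Ez)).
Qed.

Lemma gfun_conv_env_fin_num x : conv_env g x \is a fin_num.
Proof.
have [z Ez] := E0; have [zc zl] := lower_convex_lsc z.
exact: (conv_env_fin_num zc zl (fun x => lower_le_g x Ez)).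
Qed.

Let c_bounded x : exists B, forall h, `|h| <= 1 -> c (x + h) <= B.
Proof.
have [y Ey] := E0.
exists (f y + `|G y| * (`|x - y| + 1) + M / 2 * (`|x - y| + 1) ^+ 2
  + M / 2 * (`|x| + 1) ^+ 2) => h h1.
apply: le_trans (c_le_g _) _; apply: le_trans (g_le _ Ey) _.
have xyh : `|x + h - y| <= `|x - y| + 1.
  by rewrite addrAC; apply: le_trans (ler_normD _ _) _; rewrite lerD2l.
have xh : `|x + h| <= `|x| + 1.
  by apply: le_trans (ler_normD _ _) _; rewrite lerD2l.
have M20 : 0 <= M / 2 by rewrite divr_ge0 // ltW.
rewrite /upper !lerD ?ler_wpM2l ?ler_pXn2r ?nnegrE ?addr_ge0 //.
apply: le_trans (ler_ip _ _) _.
by rewrite ler_wpM2l.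
Qed.

Let c_gradient x : exists v, forall h,
  0 <= c (x + h) - c x - ip v h <= M * `|h| ^+ 2.
Proof.
have [z Ez] := E0; have [zc zl] := lower_convex_lsc z.
have [B xB] := c_bounded x.
apply: (convex_semiconcave_gradient _ _ xB).
- exact: (fine_conv_env_convex zc zl (fun x => lower_le_g x Ez)).
- exact: (fine_conv_env_semiconcave zc zl (fun x => lower_le_g x Ez)).
Qed.

Lemma Fext_gradient :
  (forall x, differentiable F x) /\ parabola_bounds M F (grad ip F).
Proof.
have [D cD] := choice c_gradient.
have FD := sub_sqr_parabola_bounds cD (fun x => erefl (F x)).
have M20 : 0 <= M / 2 by rewrite divr_ge0 // ltW.
split=> [x|x h]; have [dF gF] := diff_of_quadratic_bound M20 (FD x) => //.
by rewrite gF.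
Qed.

Lemma Fext_lipschitz x y : `|grad ip F x - grad ip F y| <= M * `|x - y|.
Proof. exact: (parabola_bounds_lipschitz M0 Fext_gradient.2). Qed.

Let Fext_bounds z x : E z ->
  f z + ip (G z) (x - z) - M / 2 * `|x - z| ^+ 2 <= F x /\
  F x <= f z + ip (G z) (x - z) + M / 2 * `|x - z| ^+ 2.
Proof.
move=> Ez; have [zc zl] := lower_convex_lsc z; split.
  rewrite lerBrDr; exact: (le_c zc zl (fun x => lower_le_g x Ez)).
by rewrite lerBlDr; apply: le_trans (c_le_g x) (g_le x Ez).
Qed.

Lemma Fext_eq z : E z -> F z = f z.
Proof.
move=> /(Fext_bounds z); rewrite subrr ip0r normr0 expr0n mulr0 subr0 !addr0.
by move=> [? ?]; apply/le_anti/andP.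
Qed.

Lemma grad_Fext_eq z : E z -> grad ip F z = G z.
Proof.
move=> Ez; have M20 : 0 <= M / 2 by rewrite divr_ge0 // ltW.
apply: (diff_of_quadratic_bound M20 _).2 => h.
have := Fext_bounds (z + h) Ez; rewrite (addrAC z h) subrr add0r (Fext_eq Ez).
by move: (F _) (ip _ _) => F1 i [h1 h2]; rewrite ler_norml; apply/andP; split; lra.
Qed.

(** H + M / 2 * `|.| ^+ 2 is one of the convex functions over which the envelope
takes its supremum. *)
Lemma Fext_max (H : X -> R) :
  (forall x, differentiable H x) ->
  (forall x, E x -> H x = f x) -> (forall x, E x -> grad ip H x = G x) ->
  (forall x y, `|grad ip H x - grad ip H y| <= M * `|x - y|) ->
  forall x, H x <= F x.
Proof.
move=> dH HE gH HM x.
have HD := lipschitz_grad_parabola_bounds dH (fun x => gradE (dH x)) HM.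
have [Hc Hl] := parabola_bounds_add_sqr_convex_lsc HD.
rewrite lerBrDr; apply: (le_c Hc Hl) => {}x; apply: le_g => y Ey.
have := HD y (x - y); rewrite subrKC (HE y Ey) (gH y Ey) ler_norml lerD2r.
move=> /andP[_].
move: (H _) (ip _ _) => a b; lra.
Qed.

End Extension.

End HilbertSpace.

Theorem theorem3p4 (R : realType) (X : completeNormedModType R)
    (ip : {dot X for (@idfun R)})
    (ip_norm : forall x : X, ip x x = `|x| ^+ 2)
    (E : set X) (f : X -> R) (G : X -> X) (M : R) :
  E !=set0 -> 0 < M -> W11 ip E f G M ->
  let g := gfun ip E f G M in
  let F := Fext ip E f G M in
  [/\ (* the infimum and the envelope in the formula are finite *)
      (forall x, has_inf (paraboloids ip E f G M x)) /\
        (forall x, conv_env g x \is a fin_num),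
      C11 ip F,
      (forall x, E x -> F x = f x),
      (forall x, E x -> grad ip F x = G x) &
      (Lip (grad ip F) <= M%:E)%E] /\
  (forall H : X -> R, C11 ip H ->
     (forall x, E x -> H x = f x) ->
     (forall x, E x -> grad ip H x = G x) ->
     (Lip (grad ip H) <= M%:E)%E ->
     forall x, H x <= F x).
Proof.
move=> E0 M0 fG g F.
have [dF _] := Fext_gradient ip_norm E0 M0 fG.
have FM := Fext_lipschitz ip_norm E0 M0 fG.
split; first split.
- split; first exact: (paraboloids_has_inf ip_norm E0 M0 fG).
  exact: (gfun_conv_env_fin_num ip_norm E0 M0 fG).
- split=> //; apply: (@klipschitzW _ _ _ M) => [|[x y] _]; last exact: FM.
  exact: (@globally_properfilter _ _ (0, 0)).
- exact: (Fext_eq ip_norm E0 M0 fG).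
- exact: (grad_Fext_eq ip_norm E0 M0 fG).
- exact: (Lip_le (ltW M0) FM).
- move=> H [dH _] HE gH /le_Lip HM.
  exact: (Fext_max ip_norm E0 M0 fG dH HE gH HM).
Qed.
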